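(* Let $F_{\underline{321}}(x,t,z)=\sum_{n\ge0}\sum_{\pi\in\mathbf I_n(3412)}x^n t^{\mathrm{occ}_{321}(\pi)}z^{\mathrm{fix}(\pi)}$. Then $aF_{\underline{321}}^2+bF_{\underline{321}}+c=0$, where $a=2x^3zt-2x^4z^2t+x^2t^2-2x^3zt^2+x^4z^2t^2+x^4z^2$, $b=-1+xz-x^3zt-x^2t^2+x^2+x^3zt^2$, and $c=1$.
   Context: $\mathbf I_n(3412)$ is the set of involutions of $\{1,\dots,n\}$ with no subsequence order-isomorphic to $3412$. $\mathrm{occ}_{321}(\pi)$ is the number of indices $i$ such that $\pi_i\pi_{i+1}\pi_{i+2}$ is order-isomorphic to $321$, and $\mathrm{fix}(\pi)$ is the number of fixed points. *)

(* Defs.v *)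
From HB Require Import structures.
From mathcomp Require Import all_boot all_order all_fingroup all_algebra.
From mathcomp Require Import boolp.

Set Implicit Arguments.
Unset Strict Implicit.
Unset Printing Implicit Defensive.

Import GRing.Theory.
Local Open Scope ring_scope.

(* R[[x]], a series being its sequence of coefficients; [fps_mul] is the Cauchy
   product. *)
Record fps (R : Type) : Type := Fps { fps_coef : nat -> R }.

Lemma fps_ext (R : Type) (f g : fps R) :
  fps_coef f =1 fps_coef g -> f = g.
Proof. by case: f g => [f] [g] /= fg; congr Fps; apply: funext. Qed.

HB.instance Definition _ (R : Type) := gen_eqMixin (fps R).
HB.instance Definition _ (R : Type) := gen_choiceMixin (fps R).

Section FpsRing.
Variable R : comNzRingType.
Implicit Types f g h : fps R.

Definition fps_zero : fps R := Fps (fun=> 0).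
Definition fps_opp f : fps R := Fps (fun n => - fps_coef f n).
Definition fps_add f g : fps R := Fps (fun n => fps_coef f n + fps_coef g n).
Definition fps_const (c : R) : fps R := Fps (fun n => if n is 0 then c else 0).
Definition fps_one : fps R := fps_const 1.
Definition fps_mul f g : fps R :=
  Fps (fun n => \sum_(i < n.+1) fps_coef f i * fps_coef g (n - i)).
Definition fps_var : fps R := Fps (fun n => (n == 1)%:R).

Lemma fps_addA : associative fps_add.
Proof. by move=> f g h; apply: fps_ext => n; apply: addrA. Qed.
Lemma fps_addC : commutative fps_add.
Proof. by move=> f g; apply: fps_ext => n; apply: addrC. Qed.
Lemma fps_add0 : left_id fps_zero fps_add.
Proof. by move=> f; apply: fps_ext => n; apply: add0r. Qed.
Lemma fps_addN : left_inverse fps_zero fps_opp fps_add.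
Proof. by move=> f; apply: fps_ext => n; apply: addNr. Qed.

HB.instance Definition _ :=
  GRing.isZmodule.Build (fps R) fps_addA fps_addC fps_add0 fps_addN.

Definition fps_trunc N f : {poly R} := \poly_(i < N) fps_coef f i.

Lemma fps_mul_trunc N f g n : (n < N)%N ->
  fps_coef (fps_mul f g) n = (fps_trunc N f * fps_trunc N g)`_n.
Proof.
move=> ltnN; rewrite coefM; apply: eq_bigr => i _.
rewrite !coef_poly (leq_ltn_trans (leq_subr _ _) ltnN).
by rewrite (leq_ltn_trans _ ltnN) // -ltnS.
Qed.

Lemma fps_mulC : commutative fps_mul.
Proof.
by move=> f g; apply: fps_ext => n; rewrite !(@fps_mul_trunc n.+1) // mulrC.
Qed.

Lemma fps_mulA : associative fps_mul.
Proof.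
move=> f g h; apply: fps_ext => n.
transitivity ((fps_trunc n.+1 f * fps_trunc n.+1 g * fps_trunc n.+1 h)`_n).
  rewrite -mulrA coefM; apply: eq_bigr => i _.
  rewrite coef_poly ltn_ord; congr (_ * _).
  by rewrite (@fps_mul_trunc n.+1) // ltnS leq_subr.
rewrite coefM; apply: eq_bigr => i _.
by rewrite -fps_mul_trunc // [in RHS]/fps_mul /= coef_poly ltnS leq_subr.
Qed.

Lemma fps_mul1 : left_id fps_one fps_mul.
Proof.
move=> f; apply: fps_ext => n /=.
rewrite big_ord_recl /= mul1r subn0 big1 ?addr0 // => i _.
by rewrite mul0r.
Qed.

Lemma fps_mulDl : left_distributive fps_mul fps_add.
Proof.
move=> f g h; apply: fps_ext => n /=; rewrite -big_split /=.
by apply: eq_bigr => i _; rewrite mulrDl.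
Qed.

Lemma fps_one_neq0 : fps_one != 0.
Proof.
by apply/eqP => /(congr1 (fun f => fps_coef f 0)) /= /eqP; rewrite oner_eq0.
Qed.

HB.instance Definition _ := GRing.Zmodule_isComNzRing.Build (fps R)
  fps_mulA fps_mulC fps_mul1 fps_mulDl fps_one_neq0.

End FpsRing.

Arguments fps_var {R}.

Local Open Scope nat_scope.

Definition order_iso (s u : seq nat) : bool :=
  (size s == size u) &&
  [forall i : 'I_(size s), forall j : 'I_(size s),
     (nth 0 s i < nth 0 s j) == (nth 0 u i < nth 0 u j)].

(* One-line notation pi_1 ... pi_n on the letters 1..n; the letter pi_(i+1)
   is the item of index i. *)
Definition word n (pi : 'S_n) : seq nat := [seq (pi i).+1 | i <- enum 'I_n].

Definition contains n (pi : 'S_n) (sigma : seq nat) : bool :=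
  [exists m : n.-tuple bool, order_iso (mask m (word pi)) sigma].

(* The size test in [order_iso] discards the truncated factors at the end. *)
Definition occ n (sigma : seq nat) (pi : 'S_n) : nat :=
  count (fun i => order_iso (take (size sigma) (drop i (word pi))) sigma)
        (iota 0 n).

Definition fix_pts n (pi : 'S_n) : nat := #|[set i | pi i == i]|.

Definition Inv_avoiding n (sigma : seq nat) : {set 'S_n} :=
  [set pi : 'S_n | [forall i, pi (pi i) == i] && ~~ contains pi sigma].

Local Open Scope ring_scope.

(* Z[t,z] is represented as Z[z][t]. *)
Definition Ztz : comNzRingType := {poly {poly int}}.
Definition t0 : Ztz := 'X.
Definition z0 : Ztz := ('X)%:P.

Definition x : fps Ztz := fps_var.
Definition t : fps Ztz := fps_const t0.
Definition z : fps Ztz := fps_const z0.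

(* Series in Z[t,z][[x]]: the coefficient of x^n is the inner sum over
   I_n(3412). *)
Definition F321 : fps Ztz :=
  Fps (fun n => \sum_(pi in Inv_avoiding n [:: 3; 4; 1; 2]%N)
                  t0 ^+ occ [:: 3; 2; 1]%N pi * z0 ^+ fix_pts pi).

(* Main.v *)
Require Import Defs.
From mathcomp Require Import all_boot all_order all_fingroup all_algebra.
From mathcomp Require Import zify ring.

(* A crossing i < j < pi i < pi j of an involution is an occurrence of 3412 at
   the positions i, j, pi i, pi j, and conversely an occurrence of 3412 in an
   involution produces a crossing. So I_n(3412) consists of the noncrossing
   involutions: empty, or a fixed point followed by such an involution, or a
   transposition around such an involution [a], followed by another one [b].
   In the last case the first letter exceeds [a] and the closing letter is below
   both [a] and [b], so the only new occurrences of 321 are [a] itself when it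
   is a single letter, and one for each end of [a] that is a descent. Let F, V,
   Y, U count the involutions with weight t^e z^fix, where e is respectively
   occ_321, the occ_321 of the involution nested in a transposition, occ_321
   plus [ends with a descent], and the latter plus [is empty]. Then
     F = 1 + xzF + x^2 V F,     Y = 1 + xzY + x^2 V U,
     U = Y + t - 1,             V = 1 + xzU + x^2 t V U,
   and eliminating V, Y, U gives the equation of F. *)

Set Implicit Arguments.
Unset Strict Implicit.
Unset Printing Implicit Defensive.

Import GRing.Theory.

(** * Noncrossing involutions and their decomposition by the first letter *)

(* Words are 0-based one-line notations: [cfix s] prepends a fixed point to [s],
   and [carc a b] nests [a] under a transposition that is followed by [b]. *)
Definition cfix (s : seq nat) := 0 :: map S s.

Definition carc (a b : seq nat) :=
  (size a).+1 :: map S a ++ 0 :: map (addn (size a).+2) b.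

(** The default 0 of [nth] makes positions outside the word harmless: such an i admits no j below 0,
    and such a j has the value 0. *)
Definition noncrossing_inv (s : seq nat) :=
  (forall i, i < size s ->
     nth 0 s i < size s /\ nth 0 s (nth 0 s i) = i) /\
  (forall i j, i < j < nth 0 s i -> nth 0 s j <= nth 0 s i).

Lemma size_cfix s : size (cfix s) = (size s).+1.
Proof. by rewrite /= size_map. Qed.

Lemma size_carc a b : size (carc a b) = (size a + size b).+2.
Proof. by rewrite /= size_cat /= !size_map addnS. Qed.

Lemma nth_cfixS s i : i < size s -> nth 0 (cfix s) i.+1 = (nth 0 s i).+1.
Proof. by move=> lt_is; rewrite /= (nth_map 0). Qed.

Lemma nth_carc_in a b i :
  i < size a -> nth 0 (carc a b) i.+1 = (nth 0 a i).+1.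
Proof. by move=> lt_ia; rewrite /= nth_cat size_map lt_ia (nth_map 0). Qed.

Lemma nth_carc_close a b : nth 0 (carc a b) (size a).+1 = 0.
Proof. by rewrite /= nth_cat size_map ltnn subnn. Qed.

Lemma nth_carc_out a b i : i < size b ->
  nth 0 (carc a b) ((size a).+2 + i) = (size a).+2 + nth 0 b i.
Proof.
move=> lt_ib; rewrite /= nth_cat size_map.
rewrite ifF; last by lia.
by rewrite (_ : _ - _ = i.+1) /= ?(nth_map 0) //; lia.
Qed.

Lemma noncrossing_inv_cfix s : noncrossing_inv (cfix s) <-> noncrossing_inv s.
Proof.
have sz := size_cfix s; have nS := @nth_cfixS s.
have n0 : nth 0 (cfix s) 0 = 0 by [].
move: (cfix s) sz nS n0 => c sz nS n0; rewrite /noncrossing_inv sz.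
split=> -[inv nc]; split.
- move=> i lt_i; have [] := inv i.+1 lt_i; rewrite nS // => lt_ni.
  by rewrite nS // => -[].
- move=> i j /andP[ij ji].
  have [lt_j|le_j] := ltnP j (size s); last by rewrite nth_default.
  have lt_i : i < size s by lia.
  by have := nc i.+1 j.+1; rewrite !nS //; apply; lia.
- move=> [_|i lt_i]; first by rewrite n0 n0.
  by rewrite nS // !ltnS; have [lt_ni ni] := inv i lt_i; rewrite nS // ni.
- move=> [|i] [|j] //; first by rewrite n0; lia.
  move=> /andP[ij ji].
  have [lt_j|le_j] := ltnP j (size s); last by rewrite nth_default // sz.
  have lt_i : i < size s by lia.
  by move: ji; rewrite !nS // => ji; rewrite ltnS nc //; lia.
Qed.

(** Serves for case analysis on a position of [carc a b] and its letter at once; the last case is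
    the default value of [nth]. *)
Variant carc_index a b : nat -> nat -> Prop :=
  | CarcOpen : carc_index a b 0 (size a).+1
  | CarcIn i of i < size a : carc_index a b i.+1 (nth 0 a i).+1
  | CarcClose : carc_index a b (size a).+1 0
  | CarcOut i of i < size b :
      carc_index a b ((size a).+2 + i) ((size a).+2 + nth 0 b i)
  | CarcBeyond i of (size a + size b).+2 <= i : carc_index a b i 0.

Lemma carcP a b i : carc_index a b i (nth 0 (carc a b) i).
Proof.
case: i => [|i]; first exact: CarcOpen.
have [lt_ia|lt_ai|->] := ltngtP i (size a).
- by rewrite nth_carc_in //; apply: CarcIn.
- have -> : i.+1 = (size a).+2 + (i - (size a).+1) by lia.
  have [lt_b|le_b] := ltnP (i - (size a).+1) (size b).
    by rewrite nth_carc_out //; apply: CarcOut.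
  by rewrite nth_default ?size_carc; last lia; apply: CarcBeyond; lia.
- by rewrite nth_carc_close; apply: CarcClose.
Qed.

Lemma noncrossing_inv_carc a b :
  noncrossing_inv (carc a b) <-> noncrossing_inv a /\ noncrossing_inv b.
Proof.
have sz := size_carc a b; have cP := @carcP a b.
have n0 : nth 0 (carc a b) 0 = (size a).+1 by [].
have nI := @nth_carc_in a b; have nC := nth_carc_close a b.
have nO := @nth_carc_out a b.
move: (carc a b) sz cP n0 nI nC nO => c sz cP n0 nI nC nO.
rewrite /noncrossing_inv sz; split=> [[inv nc]|[[inva nca] [invb ncb]]].
- have ina i : i < size a -> nth 0 a i < size a.
    (* The opening letter bounds those under the arc; equality is excluded because the closing
       position is already paired with 0. *)
    move=> lt_i; have := nc 0 i.+1; rewrite n0 nI // !ltnS => /(_ lt_i) le_i.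
    rewrite ltn_neqAle le_i andbT; apply/eqP => eq_i.
    have [|_] := inv i.+1; first lia.
    by rewrite nI // eq_i nC.
  split; split.
  + move=> i lt_i; have lt_ni := ina i lt_i; split=> //.
    by have [|_] := inv i.+1; first lia; rewrite !nI // => -[].
  + move=> i j /andP[ij ji].
    have [lt_j|le_j] := ltnP j (size a); last by rewrite nth_default.
    have lt_i : i < size a by lia.
    by have := nc i.+1 j.+1; rewrite !nI //; apply; lia.
  + move=> i lt_i; have [|] := inv ((size a).+2 + i); first lia.
    rewrite nO // => lt_ni; have lt_b : nth 0 b i < size b by lia.
    by rewrite nO // => eq_i; split=> //; lia.
  + move=> i j /andP[ij ji].
    have [lt_j|le_j] := ltnP j (size b); last by rewrite nth_default.
    have lt_i : i < size b by lia.
    have := nc ((size a).+2 + i) ((size a).+2 + j).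
    by rewrite !nO // leq_add2l; apply; lia.
- split.
  + move=> i; case: (cP i) => {i} [|i lt_i|_|i lt_i|i]; last by lia.
    * by rewrite nC; lia.
    * by have [lt_ni eq_i] := inva i lt_i; rewrite nI // eq_i; lia.
    * by rewrite n0; lia.
    * by have [lt_ni eq_i] := invb i lt_i; rewrite nO // eq_i; lia.
  + move=> i j; case: (cP i) => {i} [|i lt_i||i lt_i|i]; [| |by lia| |by lia].
    * by case: (cP j) => {j} [|j lt_j||j lt_j|j] //=; try lia;
        have [] := inva j lt_j; lia.
    * have [lt_ni _] := inva i lt_i.
      case: (cP j) => {j} [|j lt_j||j lt_j|j] //=; try lia.
      by move=> ij; rewrite ltnS nca //; lia.
    * case: (cP j) => {j} [|j lt_j||j lt_j|j] //=; try lia.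
      by have := ncb i j; lia.
Qed.

Lemma noncrossing_inv_nil : noncrossing_inv [::].
Proof. by split=> [i|i j]; rewrite // !nth_nil. Qed.

Lemma noncrossing_inv_ltn s : noncrossing_inv s -> all (ltn^~ (size s)) s.
Proof. by case=> inv _; apply/(all_nthP 0) => i /inv[]. Qed.

Variant noncrossing_inv_split : seq nat -> Prop :=
  | SplitNil : noncrossing_inv_split [::]
  | SplitFix s of noncrossing_inv s : noncrossing_inv_split (cfix s)
  | SplitArc a b of noncrossing_inv a & noncrossing_inv b :
      noncrossing_inv_split (carc a b).

Lemma noncrossing_invP s : noncrossing_inv s -> noncrossing_inv_split s.
Proof.
case: s => [|h s]; first by move=> _; exact: SplitNil.
move=> nis; have [/= inv nc] := nis.
have [lt_h nh] : h < (size s).+1 /\ nth 0 (h :: s) h = 0 by have := inv 0 isT.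
case: h => [|h] /= in nis inv nc lt_h nh *.
  have def_s : 0 :: s = cfix (map predn s).
    congr (_ :: _); apply: (@eq_from_nth _ 0); rewrite ?size_map // => i lt_i.
    rewrite (nth_map 0) ?size_map // (nth_map 0) // prednK //.
    have [//|_] := inv i.+1; rewrite /=.
    by case: (nth 0 s i).
  by rewrite def_s in nis *; apply: SplitFix; apply/noncrossing_inv_cfix.
(* [predn] and truncated subtraction undo the shifts of [carc] only on large enough letters, hence
   [f_gt0] and [f_out]. *)
have def_s : h.+1 :: s =
    carc (map predn (take h s)) (map (subn^~ h.+2) (drop h.+1 s)).
  have szt : size (take h s) = h by rewrite size_takel //; lia.
  set f := nth 0 (h.+1 :: s) in inv nc nh.
  have f_gt0 i : i < (size s).+1 -> i != h.+1 -> 0 < f i.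
    move=> lt_i ne_i; have [_] := inv i lt_i.
    by case: (f i) => // eq_i; rewrite -eq_i eqxx in ne_i.
  (* If f i were below h+1, noncrossing with the arc from 0 to h+1 would give i = f (f i) <= h+1; if
     f i = h+1, then i would be 0. *)
  have f_out i : i < (size s).+1 -> h.+1 < i -> h.+1 < f i.
    move=> lt_i lt_hi; have [_ ffi] := inv i lt_i.
    have := f_gt0 i lt_i; have := nc 0 (f i).
    rewrite (_ : f 0 = h.+1) // ffi => nc1 fi_gt0.
    have [lt_fi|//|eq_fi] := ltngtP (f i) h.+1; first by lia.
    by move: ffi; rewrite eq_fi [f _]nh; lia.
  apply: (@eq_from_nth _ 0).
    by rewrite size_carc !size_map size_drop szt /=; lia.
  move=> i lt_i; have := f_gt0 i lt_i; have := f_out i lt_i; move: lt_i.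
  case: carcP => {i} [|i||i|i]; rewrite !size_map ?szt ?size_drop //=.
  - move=> lt_i _ _; rewrite /f /= => fi_gt0.
    rewrite (nth_map 0) ?szt // nth_take // prednK //; apply: fi_gt0; lia.
  - move=> lt_i lt_i2; rewrite /f /= => fi_gt _.
    rewrite (nth_map 0) ?size_drop // nth_drop subnKC //; apply: fi_gt; lia.
  - by lia.
by rewrite def_s in nis *; have /noncrossing_inv_carc[] := nis; apply: SplitArc.
Qed.

(** * Occurrences of 321, descents and fixed points of a decomposed word *)

Fixpoint occ321 (s : seq nat) : nat :=
  if s is a :: s1 then
    (if s1 is b :: c :: _ then (c < b < a) : nat else 0) + occ321 s1
  else 0.

Definition start_descent (s : seq nat) : bool :=
  if s is a :: b :: _ then b < a else false.

Fixpoint end_descent (s : seq nat) : bool :=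
  if s is a :: s1 then
    if s1 is [:: b] then b < a else end_descent s1
  else false.

(* [fixed_from k s] counts the fixed points of the word [s] placed at the
   positions k, k + 1, ... *)
Fixpoint fixed_from k (s : seq nat) : nat :=
  if s is a :: s1 then (a == k) + fixed_from k.+1 s1 else 0.

Lemma occ321_map f s : {mono f : m n / m < n} -> occ321 (map f s) = occ321 s.
Proof.
by move=> mf; elim: s => //= a s ->; case: s => [|b [|c s]] //=; rewrite !mf.
Qed.

Lemma start_descent_map f s :
  {mono f : m n / m < n} -> start_descent (map f s) = start_descent s.
Proof. by move=> mf; case: s => [|a [|b s]] //=; rewrite mf. Qed.

Lemma end_descent_map f s :
  {mono f : m n / m < n} -> end_descent (map f s) = end_descent s.
Proof.
by move=> mf; elim: s => //= a s ->; case: s => [|b [|c s]] //=; rewrite mf.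
Qed.

Lemma fixed_from_map k j s :
  fixed_from (j + k) (map (addn j) s) = fixed_from k s.
Proof. by elim: s k => //= a s IHs k; rewrite eqn_add2l -addnS IHs. Qed.

Lemma fixed_from_cat k u v :
  fixed_from k (u ++ v) = fixed_from k u + fixed_from (k + size u) v.
Proof.
elim: u k => [|a u IHu] k /=; first by rewrite addn0.
by rewrite IHu addSnnS addnA.
Qed.

Lemma occ321_cons0 s : occ321 (0 :: s) = occ321 s.
Proof. by case: s => [|a [|b s]] //=; rewrite ltn0 andbF. Qed.

(** No letter lies below 0, so 0 can only end a 321, and cutting right after it loses no
    occurrence. *)
Lemma occ321_cat0 s v : all (ltn 0) v ->
  occ321 (s ++ 0 :: v) = occ321 (rcons s 0) + occ321 v.
Proof.
move=> v_gt0; elim: s => [|a s IHs]; first by rewrite cat0s occ321_cons0.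
rewrite rcons_cons cat_cons [LHS]/= IHs /= addnA; congr (_ + _ + _).
by case: s {IHs} => [|b [|c s]] //=; case: v v_gt0.
Qed.

(** Being below all of [s], the final 0 completes a 321 exactly when it follows a descent. *)
Lemma occ321_rcons0 s : all (ltn 0) s ->
  occ321 (rcons s 0) = occ321 s + end_descent s.
Proof.
elim: s => //= a s IHs /andP[a_gt0 s_gt0]; rewrite IHs //.
case: s s_gt0 {IHs} => [|b [|c s]] //=; last by rewrite addnA.
by rewrite andbT => ->; rewrite !addn0 add0n.
Qed.

Lemma occ321_cons_max k s : all (ltn^~ k) s ->
  occ321 (k :: s) = start_descent s + occ321 s.
Proof. by case: s => [|a [|b s]] //= /andP[-> _]; rewrite andbT. Qed.

Lemma end_descent_cons_max k s : all (ltn^~ k) s ->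
  end_descent (k :: s) = (size s == 1) || end_descent s.
Proof. by case: s => [|a [|b s]] //= /andP[-> _]. Qed.

Lemma end_descent_cons0 s : end_descent (0 :: s) = end_descent s.
Proof. by case: s => [|a [|b s]]. Qed.

Lemma end_descent_cat0 u v : v != [::] ->
  end_descent (u ++ 0 :: v) = end_descent v.
Proof.
move=> nv; elim: u => [|a u IHu]; first by rewrite cat0s end_descent_cons0.
by rewrite cat_cons -IHu /=; case: u {IHu} => [|b [|c u]] //=; case: v nv.
Qed.

Lemma end_descent_rcons0 s : end_descent (rcons s 0) = (0 < last 0 s).
Proof.
elim/last_ind: s => // s a _; rewrite last_rcons.
by elim: s => //= b s; case: s => //= c s; case: s.
Qed.

(* The number of occurrences of 321 in the word [carc a [::]]: to those of [a],
   its first and last letters add one for each end of [a] that is a descent,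
   and one when [a] is a single letter. *)
Definition nested_occ321 a :=
  occ321 a + start_descent a + ((size a == 1) + end_descent a).

Lemma mono_addn k : {mono addn k : m n / m < n}.
Proof. by move=> m n; rewrite ltn_add2l. Qed.

Lemma mono_S : {mono S : m n / m < n}. Proof. by []. Qed.

Lemma map_S_lt a k : all (ltn^~ k) a -> all (ltn^~ k.+1) (map S a).
Proof. by move=> a_lt; rewrite all_map; apply: sub_all a_lt => i /=. Qed.

Lemma occ321_carc a b : all (ltn^~ (size a)) a ->
  occ321 (carc a b) = nested_occ321 a + occ321 b.
Proof.
move=> /map_S_lt a_lt.
rewrite /carc -cat_cons occ321_cat0; last by rewrite all_map; apply/allP.
rewrite (occ321_map _ (mono_addn _)) occ321_rcons0; last first.
  by rewrite /= all_map; apply/allP.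
rewrite occ321_cons_max // end_descent_cons_max // size_map.
rewrite (occ321_map _ mono_S) (start_descent_map _ mono_S).
rewrite (end_descent_map _ mono_S) /nested_occ321 [start_descent a + _]addnC.
(* A word of one letter has no descent, so the disjunction is a sum. *)
by congr (_ + _ + _); case: (a) => [|? [|? ?]].
Qed.

(** When [b] is empty, the word ends with a descent to the closing letter 0; otherwise this 0
    precedes the shifted [b] and creates no descent there. *)
Lemma end_descent_carc a b :
  end_descent (carc a b) = (size b == 0) + end_descent b :> nat.
Proof.
rewrite /carc -cat_cons; case: (altP (b =P [::])) => [->|nb].
  by rewrite [map _ [::]]/= cats1 end_descent_rcons0 /= last_map.
rewrite end_descent_cat0; last by case: b nb.
by rewrite (end_descent_map _ (mono_addn _)) size_eq0 (negPf nb).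
Qed.

Lemma start_descent_carc a b :
  all (ltn^~ (size a)) a -> start_descent (carc a b).
Proof. by case: a => //= c s /andP[]. Qed.

Lemma fixed_carc a b :
  fixed_from 0 (carc a b) = fixed_from 0 a + fixed_from 0 b.
Proof.
rewrite /= fixed_from_cat size_map /= add1n.
rewrite -(fixed_from_map 0 1) -[in RHS](fixed_from_map 0 (size a).+2) !addn0.
by rewrite !add0n.
Qed.

(** The successor comes from the descent at the opening letter of [carc a b]; it is the factor t in
    the equation of V. *)
Lemma nested_occ321_carc a b : all (ltn^~ (size a)) a ->
  nested_occ321 (carc a b) =
  (nested_occ321 a + (occ321 b + ((size b == 0) + end_descent b))).+1.
Proof.
move=> a_lt.
rewrite /nested_occ321 occ321_carc // start_descent_carc // end_descent_carc.
by rewrite size_carc /= /nested_occ321; lia.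
Qed.

Lemma occ321_cfix a : occ321 (cfix a) = occ321 a.
Proof. by rewrite occ321_cons0 (occ321_map _ mono_S). Qed.

Lemma end_descent_cfix a : end_descent (cfix a) = end_descent a.
Proof. by rewrite end_descent_cons0 (end_descent_map _ mono_S). Qed.

(** A word starting with 0 has no initial descent, and [cfix a] is a single letter when [a] is
    empty; this is how U enters the equation of V. *)
Lemma nested_occ321_cfix a : nested_occ321 (cfix a) =
  occ321 a + ((size a == 0) + end_descent a).
Proof.
rewrite /nested_occ321 occ321_cfix end_descent_cfix size_cfix eqSS.
by rewrite (_ : start_descent _ = false) ?addn0 // /cfix; case: (a).
Qed.

Lemma fixed_cfix a : fixed_from 0 (cfix a) = (fixed_from 0 a).+1.
Proof.
by rewrite /= -[in RHS](fixed_from_map 0 1) addn0.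
Qed.

(** * Listing the noncrossing involutions of each size *)

Definition next_words (T : nat -> seq (seq nat)) m : seq (seq nat) :=
  [seq cfix s | s <- T m] ++
  [seq carc p.1 p.2 | i <- iota 0 m,
                      p <- [seq (a, b) | a <- T i, b <- T (m.-1 - i)]].

(** All smaller sizes are called, so the recursion is structural in a fuel [k]; the value at [n] is
    the same for every k >= n. *)
Fixpoint words_rec k n : seq (seq nat) :=
  if n is m.+1 then if k is k1.+1 then next_words (words_rec k1) m else [::]
  else [:: [::]].

Definition words n := words_rec n n.

Lemma words_recE k n : n <= k -> words_rec k n = words n.
Proof.
rewrite /words; have [r] := ubnP n.
elim: r k n => // r IHr [|k] [|n] //= lt_nr le_nk.
have E i : i <= n -> words_rec k i = words_rec n i.
  by move=> le_in; rewrite IHr ?(IHr n i) //; lia.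
rewrite /next_words E //; congr (_ ++ flatten _).
apply/eq_in_map => i; rewrite mem_iota => lt_in.
by rewrite !E //; lia.
Qed.

Lemma wordsS m : words m.+1 = next_words words m.
Proof.
rewrite /words /= /next_words; congr (_ ++ flatten _).
apply/eq_in_map => i; rewrite mem_iota => lt_in.
by rewrite !words_recE //; lia.
Qed.

Lemma mem_words n s : s \in words n <-> noncrossing_inv s /\ size s = n.
Proof.
have [r] := ubnP n; elim: r n s => // r IHr [|m] s lt_nr.
  rewrite inE; split=> [/eqP->|[_ /size0nil->]] //.
  by split; first exact: noncrossing_inv_nil.
have lt_r i : i <= m -> i < r by lia.
rewrite wordsS mem_cat; split=> [/orP[/mapP[s1]|/allpairsPdep[i [p []]]]|].
- move=> /(IHr _ _ (lt_r _ (leqnn m)))[nc sz] ->.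
  by rewrite size_cfix sz; split=> //; apply/noncrossing_inv_cfix.
- rewrite mem_iota => lt_im /allpairsP[[a b] [/= aT bT ->]] ->.
  have [|nca sza] := (IHr _ _ _).1 aT; first by apply: lt_r; lia.
  have [|ncb szb] := (IHr _ _ _).1 bT; first by apply: lt_r; lia.
  rewrite size_carc; split; first exact/noncrossing_inv_carc.
  by rewrite /= sza szb; lia.
- case=> /noncrossing_invP[|s1 nc|a b nca ncb] //.
    rewrite size_cfix => -[sz]; apply/orP; left; apply: map_f.
    by apply/IHr => //; lia.
  rewrite size_carc => -[sz]; apply/orP; right.
  apply/allpairsPdep; exists (size a), (a, b); split=> //.
    by rewrite mem_iota; lia.
  apply/allpairsP; exists (a, b); split=> //=.
    by apply: (IHr _ _ _).2 => //; apply: lt_r; lia.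
  by apply: (IHr _ _ _).2; [apply: lt_r; lia | rewrite -sz /= addKn].
Qed.

Lemma cfix_inj : injective cfix.
Proof. by move=> s u [/(inj_map succn_inj)]. Qed.

(** The first letter gives the size of [a], hence the place to cut. *)
Lemma carc_inj a b a' b' : carc a b = carc a' b' -> a = a' /\ b = b'.
Proof.
case=> sz /eqP; rewrite eqseq_cat ?size_map //.
case/andP=> /eqP /(inj_map succn_inj)-> /eqP[].
by move=> /(inj_map (@addnI _))->.
Qed.

(** The first letter, 0 or positive, tells the two constructors apart, and each is injective. *)
Lemma words_uniq n : uniq (words n).
Proof.
have [r] := ubnP n; elim: r n => // r IHr [|m] // lt_nr.
rewrite wordsS cat_uniq map_inj_uniq ?IHr //=; last exact: cfix_inj.
apply/andP; split.
  apply/hasPn => s /allpairsPdep[i [p [_ _ ->]]].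
  by apply/negP => /mapP[u _].
apply: allpairs_uniq_dep; first exact: iota_uniq.
  move=> i; rewrite mem_iota => lt_im.
  by apply: allpairs_uniq; rewrite ?IHr //; try lia; move=> [? ?] [? ?].
move=> _ _ /allpairsPdep[i [p [_ ip ->]]] /allpairsPdep[j [q [_ jq ->]]] /=.
case/allpairsP: ip jq => -[a b] [/= /mem_words[_ <-] _ ->].
case/allpairsP=> -[a' b'] [/= /mem_words[_ <-] _ ->] /=.
by move=> /carc_inj[-> ->].
Qed.

(** * From permutations and pattern containment to words *)

Lemma order_isoP s u : reflect (size s = size u /\
    forall i j, i < size s -> j < size s ->
      (nth 0 s i < nth 0 s j) = (nth 0 u i < nth 0 u j)) (order_iso s u).
Proof.
apply: (iffP andP) => -[/eqP sz iso]; split=> //.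
- move=> i j lt_i lt_j.
  by have /forallP/(_ (Ordinal lt_i))/forallP/(_ (Ordinal lt_j))/eqP := iso.
- by apply/forallP => i; apply/forallP => j; apply/eqP; apply: iso.
Qed.

Lemma order_iso321 a b c : order_iso [:: a; b; c] [:: 3; 2; 1] = (c < b < a).
Proof.
apply/order_isoP/andP => [[_ iso]|[cb ba]].
  by rewrite (iso 2 1) // (iso 1 0).
by split=> // -[|[|[|i]]] [|[|[|j]]] //= _ _; lia.
Qed.

Lemma order_iso3412 a b c d :
  order_iso [:: a; b; c; d] [:: 3; 4; 1; 2] = [&& c < d, d < a & a < b].
Proof.
apply/order_isoP/and3P => [[_ iso]|[cd da ab]].
  by rewrite (iso 2 3) // (iso 3 0) // (iso 0 1).
by split=> // -[|[|[|[|i]]]] [|[|[|[|j]]]] //= _ _; lia.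
Qed.

Definition perm_word n (pi : 'S_n) : seq nat :=
  [seq val (pi i) | i <- enum 'I_n].

Lemma wordE n (pi : 'S_n) : word pi = map S (perm_word pi).
Proof. by rewrite /word /perm_word -map_comp. Qed.

Lemma size_perm_word n (pi : 'S_n) : size (perm_word pi) = n.
Proof. by rewrite size_map size_enum_ord. Qed.

Lemma nth_perm_word n (pi : 'S_n) (i : 'I_n) : nth 0 (perm_word pi) i = pi i.
Proof. by rewrite (nth_map i) ?size_enum_ord // nth_ord_enum. Qed.

Lemma perm_word_inj n : injective (@perm_word n).
Proof.
move=> p q eq_pq; apply/permP => i; apply: val_inj.
by rewrite /= -!nth_perm_word eq_pq.
Qed.

Lemma occ_perm_word n (pi : 'S_n) :
  occ [:: 3; 2; 1] pi = occ321 (perm_word pi).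
Proof.
rewrite /occ wordE -[in iota 0 n](size_perm_word pi).
elim: (perm_word pi) => //= a s <-; rewrite -[1]/(1 + 0) iotaDl count_map.
congr (_ + _); case: s => [|b [|c s]] //=.
by rewrite take0 order_iso321 !ltnS.
Qed.

Lemma fixed_fromE k s :
  fixed_from k s = count (fun i => nth 0 s i == k + i) (iota 0 (size s)).
Proof.
elim: s k => //= a s IHs k; rewrite addn0 IHs -[1]/(1 + 0) iotaDl count_map.
by congr (_ + _); apply: eq_count => i /=; rewrite addSnnS.
Qed.

Lemma fix_perm_word n (pi : 'S_n) : fix_pts pi = fixed_from 0 (perm_word pi).
Proof.
rewrite fixed_fromE size_perm_word -val_enum_ord count_map.
rewrite /fix_pts cardsE cardE size_filter -enumT.
by apply: eq_count => i /=; rewrite add0n nth_perm_word.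
Qed.

Lemma contains3412P n (pi : 'S_n) : reflect
  (exists i j k l : 'I_n, [/\ i < j, j < k & k < l] /\
                          [/\ pi k < pi l, pi l < pi i & pi i < pi j])
  (contains pi [:: 3; 4; 1; 2]).
Proof.
have ltn_enum : sorted (fun i j : 'I_n => i < j) (enum 'I_n).
  by have := iota_ltn_sorted 0 n; rewrite -val_enum_ord sorted_map.
have ltnT : transitive (fun i j : 'I_n => i < j).
  by move=> i j k; apply: ltn_trans.
apply: (iffP existsP) => [[m]|[i [j [k [l [[ij jk kl] pijkl]]]]]].
  rewrite /word -map_mask => iso.
  have: sorted (fun i j : 'I_n => i < j) (mask m (enum 'I_n)).
    exact: sorted_mask.
  have [+ _] := order_isoP _ _ iso; move: iso; rewrite size_map.
  case: (mask _ _) => [|i [|j [|k [|l [|? ?]]]]] //= iso _.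
  move: iso; rewrite order_iso3412 !ltnS => /and3P[? ? ?] /and4P[? ? ? _].
  by exists i, j, k, l.
(* The witness mask marks the four positions; filtering the increasing list of all positions by it
   returns them in order. *)
pose s := [:: i; j; k; l].
have sz : size (map (mem s) (enum 'I_n)) == n by rewrite size_map size_enum_ord.
exists (Tuple sz); rewrite /= /word -map_mask -filter_mask.
have -> : [seq i <- enum 'I_n | mem s i] = s.
  apply: (irr_sorted_eq ltnT) => [x|||x]; first exact: ltnn.
  - exact: sorted_filter.
  - by rewrite /= ij jk kl.
  - by rewrite mem_filter mem_enum andbT.
by rewrite order_iso3412 !ltnS; apply/and3P.
Qed.

Lemma Inv_avoidingP n (pi : 'S_n) :
  pi \in Inv_avoiding n [:: 3; 4; 1; 2] <-> noncrossing_inv (perm_word pi).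
Proof.
rewrite inE; split=> [/andP[/forallP inv /contains3412P ncr]|[inv ncr]].
- have {}inv i : pi (pi i) = i by exact/eqP.
  split=> i; rewrite ?size_perm_word.
    move=> lt_i; have := nth_perm_word pi (Ordinal lt_i); rewrite /= => ->.
    by rewrite nth_perm_word inv.
  move=> j /andP[ij ji]; rewrite leqNgt; apply/negP => lt_ij.
  have lt_j : j < n.
    rewrite ltnNge; apply/negP => le_nj.
    by rewrite [X in _ < X]nth_default ?size_perm_word in lt_ij.
  have lt_i : i < n by exact: ltn_trans lt_j.
  have := nth_perm_word pi (Ordinal lt_i).
  have := nth_perm_word pi (Ordinal lt_j).
  rewrite /= => ej ei; rewrite ei ej in lt_ij ji.
  (* The positions i, j, pi i, pi j carry the letters pi i, pi j, i, j. *)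
  apply: ncr; exists (Ordinal lt_i), (Ordinal lt_j).
  exists (pi (Ordinal lt_i)), (pi (Ordinal lt_j)).
  by rewrite !inv.
- have {}inv i : pi (pi i) = i.
    have [|_] := inv i; rewrite ?size_perm_word // !nth_perm_word => e.
    exact: val_inj.
  apply/andP; split; first by apply/forallP => i; rewrite inv.
  apply/contains3412P => -[i [j [k [l [[ij jk kl] [kl' li ij']]]]]].
  (* If j < pi i, then i and j cross; otherwise pi l < pi i <= j < k, and pi k and pi l cross. *)
  have := ncr i j; have := ncr (pi k) (pi l).
  by rewrite !nth_perm_word !inv; lia.
Qed.

Lemma perm_words n :
  perm_eq [seq perm_word pi | pi in Inv_avoiding n [:: 3; 4; 1; 2]] (words n).
Proof.
apply: uniq_perm.
  by rewrite map_inj_uniq ?enum_uniq //; apply: perm_word_inj.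
  exact: words_uniq.
move=> s; apply/idP/idP => [/mapP[pi]|/mem_words[nc sz]].
  rewrite mem_enum => /Inv_avoidingP nc ->.
  by apply/mem_words; rewrite size_perm_word.
have lt_s (i : 'I_n) : nth 0 s i < n by have [] := nc.1 i; rewrite sz.
(* Read as a map on positions, [s] is its own inverse, hence a permutation. *)
pose f (i : 'I_n) := Ordinal (lt_s i).
have f_inj : injective f.
  move=> i j /(congr1 val) /= eq_f; apply: val_inj => /=.
  have [|_ <-] := nc.1 i; first by rewrite sz.
  by have [|_ <-] := nc.1 j; [rewrite sz | rewrite eq_f].
have def_s : s = perm_word (perm f_inj).
  apply: (@eq_from_nth _ 0); rewrite ?size_perm_word // sz => i lt_i.
  by rewrite (nth_perm_word _ (Ordinal lt_i)) permE.
rewrite def_s; apply: map_f; rewrite mem_enum; apply/Inv_avoidingP.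
by rewrite -def_s.
Qed.

(** * Generating functions over the listed words *)

Local Open Scope ring_scope.

Lemma fps_coef_varM0 (R : comNzRingType) (f : fps R) :
  fps_coef (fps_var * f) 0 = 0.
Proof. by rewrite /GRing.mul /= big_ord1 mul0r. Qed.

Lemma fps_coef_varMS (R : comNzRingType) (f : fps R) n :
  fps_coef (fps_var * f) n.+1 = fps_coef f n.
Proof.
rewrite [LHS]big_ord_recl /= mul0r add0r big_ord_recl /= mul1r subn1 /=.
by rewrite big1 ?addr0 // => i _; rewrite mul0r.
Qed.

Lemma fps_coef_constM (R : comNzRingType) (c : R) (f : fps R) n :
  fps_coef (fps_const c * f) n = c * fps_coef f n.
Proof.
rewrite [LHS]big_ord_recl /= subn0.
by rewrite big1 ?addr0 // => i _; rewrite mul0r.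
Qed.

Lemma fps_coefD (R : comNzRingType) (f g : fps R) n :
  fps_coef (f + g) n = fps_coef f n + fps_coef g n.
Proof. by []. Qed.

Definition gf (f : seq nat -> Ztz) : fps Ztz :=
  Fps (fun n => \sum_(s <- words n) f s).

Lemma gfZ c f : gf (fun s => c * f s) = fps_const c * gf f.
Proof. by apply: fps_ext => n; rewrite fps_coef_constM /= mulr_sumr. Qed.

(** The empty word gives the constant term, a fixed point a factor x, the two ends of an arc x^2; on
    arcs the weight factors, so summing over the size of the nested word is a Cauchy product. *)
Lemma gf_split f k g h :
    (forall s, noncrossing_inv s -> f (cfix s) = k s) ->
    (forall a b, noncrossing_inv a -> noncrossing_inv b ->
       f (carc a b) = g a * h b) ->
  gf f = fps_const (f [::]) + x * gf k + x ^+ 2 * gf g * gf h.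
Proof.
move=> fix_f arc_f; rewrite expr2 -!mulrA /x; apply: fps_ext => -[|m].
  by rewrite !fps_coefD !fps_coef_varM0 /= big_seq1 !addr0.
rewrite !fps_coefD !fps_coef_varMS [in LHS]/= wordsS big_cat big_map.
rewrite [fps_coef (fps_const _) _]/= add0r.
congr (_ + _).
  by apply: eq_big_seq => s /mem_words[nc _]; apply: fix_f.
rewrite big_allpairs_dep.
(* A word of size 1 has no room for an arc. *)
case: m => [|m]; first by rewrite big_nil fps_coef_varM0.
rewrite fps_coef_varMS -[iota 0 m.+1]/(index_iota 0 m.+1) big_mkord.
apply: eq_bigr => i _; rewrite big_allpairs big_distrlr /=.
apply: eq_big_seq => a /mem_words[nca _].
by apply: eq_big_seq => b /mem_words[ncb _]; apply: arc_f.
Qed.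

Definition weight (e : seq nat -> nat) (s : seq nat) : Ztz :=
  t0 ^+ e s * z0 ^+ fixed_from 0 s.

Lemma F321E : F321 = gf (weight occ321).
Proof.
apply: fps_ext => n /=.
rewrite -(perm_big _ (perm_words n)) big_map big_enum /=.
by apply: eq_bigr => pi _; rewrite /weight occ_perm_word fix_perm_word.
Qed.

Lemma gf_weight_split e e1 e2 e3 :
    (forall s, e (cfix s) = e1 s) ->
    (forall a b, noncrossing_inv a -> noncrossing_inv b ->
       e (carc a b) = (e2 a + e3 b)%N) ->
  gf (weight e) = fps_const (t0 ^+ e [::]) + x * z * gf (weight e1)
                  + x ^+ 2 * gf (weight e2) * gf (weight e3).
Proof.
move=> fix_e arc_e.
rewrite (@gf_split _ (fun s => z0 * weight e1 s) (weight e2) (weight e3)).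
- by rewrite gfZ /weight /= mulr1 mulrA.
- by move=> s nc; rewrite /weight fixed_cfix fix_e exprS mulrCA.
- move=> a b nca ncb; rewrite /weight fixed_carc arc_e // !exprD.
  by rewrite mulrACA.
Qed.

(** * Elimination and the quadratic equation *)

Lemma quadratic_elimination (R : comNzRingType) (x t z F V Y U : R) :
  F = 1 + x * z * F + x ^+ 2 * V * F ->
  Y = 1 + x * z * Y + x ^+ 2 * V * U ->
  U = Y + t - 1 ->
  V = 1 + x * z * U + x ^+ 2 * (t * V) * U ->
  (2 * x ^+ 3 * z * t - 2 * x ^+ 4 * z ^+ 2 * t + x ^+ 2 * t ^+ 2
   - 2 * x ^+ 3 * z * t ^+ 2 + x ^+ 4 * z ^+ 2 * t ^+ 2
   + x ^+ 4 * z ^+ 2) * F ^+ 2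
  + (- 1 + x * z - x ^+ 3 * z * t - x ^+ 2 * t ^+ 2 + x ^+ 2
     + x ^+ 3 * z * t ^+ 2) * F + 1 = 0.
Proof.
move=> /eqP; rewrite -subr_eq0 => /eqP eqF.
move=> /eqP; rewrite -subr_eq0 => /eqP eqY eqU.
move=> /eqP; rewrite -subr_eq0 => /eqP eqV.
(* The coefficients of F^2 and F are x^2 w^2 and x z - 1 + x^2 - x^2 t w. *)
pose w := t + x * z - t * x * z.
have {eqU} defU : U = F * w.
  (* F times the equation of Y minus U times the equation of F cancels x^2 V F U and leaves U = F
     w. *)
  rewrite -[RHS]addr0 -(mulr0 F) -eqY -[RHS]subr0 -(mulr0 (Y + t - 1)) -eqF.
  by rewrite eqU /w; ring.
(* With the multipliers - x^2 F and x^2 t U - 1, V cancels between its own equation and that of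
   F. *)
rewrite -(mulr0 (- x ^+ 2 * F)) -eqV -[RHS]addr0.
by rewrite -(mulr0 (x ^+ 2 * t * U - 1)) -eqF defU /w; ring.
Qed.

Theorem theorem4p4 :
  let a := 2 * x ^+ 3 * z * t - 2 * x ^+ 4 * z ^+ 2 * t + x ^+ 2 * t ^+ 2
           - 2 * x ^+ 3 * z * t ^+ 2 + x ^+ 4 * z ^+ 2 * t ^+ 2
           + x ^+ 4 * z ^+ 2 in
  let b := - 1 + x * z - x ^+ 3 * z * t - x ^+ 2 * t ^+ 2 + x ^+ 2
           + x ^+ 3 * z * t ^+ 2 in
  let c := 1 in
  a * F321 ^+ 2 + b * F321 + c = 0.
Proof.
(* [y_exp] and [u_exp] are the exponents of t in Y and U. *)
pose y_exp s := (occ321 s + end_descent s)%N.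
pose u_exp s := (occ321 s + ((size s == 0%N) + end_descent s))%N.
have eqF : gf (weight occ321) = 1 + x * z * gf (weight occ321)
    + x ^+ 2 * gf (weight nested_occ321) * gf (weight occ321).
  rewrite {1}(@gf_weight_split _ occ321 nested_occ321 occ321)
    => [//|s|a b nca _].
    by rewrite occ321_cfix.
  by rewrite occ321_carc //; apply: noncrossing_inv_ltn.
have eqY : gf (weight y_exp) = 1 + x * z * gf (weight y_exp)
    + x ^+ 2 * gf (weight nested_occ321) * gf (weight u_exp).
  rewrite {1}(@gf_weight_split _ y_exp nested_occ321 u_exp) => [//|s|a b nca _].
    by rewrite /y_exp occ321_cfix end_descent_cfix.
  rewrite /y_exp occ321_carc ?end_descent_carc ?addnA //.
  exact: noncrossing_inv_ltn.
have eqU : gf (weight u_exp) = gf (weight y_exp) + t - 1.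
  (* The two exponents differ only at the empty word, of weight 1 in Y and t in U. *)
  apply: fps_ext => -[|n]; rewrite !fps_coefD /=.
    by rewrite !big_seq1 /weight /= !mulr1 expr1 expr0; ring.
  rewrite oppr0 !addr0; apply: eq_big_seq => s /mem_words[_ sz].
  by rewrite /weight /u_exp sz.
have eqV : gf (weight nested_occ321) = 1 + x * z * gf (weight u_exp)
    + x ^+ 2 * (t * gf (weight nested_occ321)) * gf (weight u_exp).
  (* The successor in [nested_occ321_carc] is attached to the nested word, where [gfZ] turns it into
     the factor t. *)
  rewrite {1}(@gf_weight_split _ u_exp (fun s => (nested_occ321 s).+1) u_exp)
    => [|s|a b nca _].
  - rewrite -gfZ; congr (_ + _ * _ * _); apply: fps_ext => n.
    by apply: eq_bigr => s _; rewrite /weight exprS mulrA.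
  - by rewrite nested_occ321_cfix.
  - by rewrite nested_occ321_carc //; apply: noncrossing_inv_ltn.
rewrite F321E.
move: (gf (weight occ321)) (gf (weight nested_occ321)) (gf (weight y_exp))
  (gf (weight u_exp)) eqF eqY eqU eqV => F V Y U eqF eqY eqU eqV.
exact: quadratic_elimination eqF eqY eqU eqV.
Qed.
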